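(* Let $G$ and $H$ be connected graphs with $d(G)\ge 2$. If $G^{(2)}\in\mathscr{C}_0$, then $(G\times H)^{(2)}\in\mathscr{C}_0$. If $G^{(2)}\in\mathscr{C}_1$, then $(G\times H)^{(2)}\in\mathscr{C}_0\cup\mathscr{C}_1$.
   Context: All graphs are finite, simple and connected; $d(\cdot)$ denotes diameter. For a graph $G$ with vertex set $\{v_1,\dots,v_n\}$ and positive integers $s_1,\dots,s_n$, the vertex-multiplication $G(s_1,\dots,s_n)$ is the graph whose vertex set is a disjoint union $V_1\cup\dots\cup V_n$ with $|V_i|=s_i$, where $u\in V_i$ and $v\in V_j$ are adjacent iff $i\ne j$ and $v_iv_j\in E(G)$; $G^{(s)}$ denotes $G(s,s,\dots,s)$. For a connected bridgeless graph $X$, the orientation number $\bar d(X)$ is the minimum diameter of a strong orientation of $X$ (the diameter of a digraph being the maximum directed distance between ordered pairs of vertices). For $j\in\{0,1,2\}$, $\mathscr{C}_j$ is the class of all vertex-multiplications $G(s_1,\dots,s_n)$ with $s_i\ge 2$ for all $i$ such that $\bar d(G(s_1,\dots,s_n))=d(G)+j$, where $G$ is the parent graph. The cartesian product $G\times H$ has vertex set $\{\langle u,x\rangle: u\in V(G),x\in V(H)\}$, with $\langle u,x\rangle\langle v,y\rangle$ an edge iff either $u=v$ and $xy\in E(H)$, or $uv\in E(G)$ and $x=y$. *)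

(* Defs.v *)
From mathcomp Require Import all_boot.
Set Implicit Arguments.
Unset Strict Implicit.
Unset Printing Implicit Defensive.

Record sgraph := SGraph {
  vertex :> finType;
  edge : rel vertex;
  edge_sym : symmetric edge;
  edge_irrefl : irreflexive edge }.

Definition connected (G : sgraph) : Prop :=
  0 < #|G| /\ forall x y : G, connect (@edge G) x y.

Section Distance.
Variables (T : finType) (e : rel T).

Definition has_walk (n : nat) (x y : T) : bool :=
  [exists p : n.-tuple T, path e x p && (last x p == y)].

(* The least length of a directed walk from x to y. A shortest walk has length
   below #|T|, so the junk value #|T| is returned exactly when y is not
   reachable from x. *)
Definition dist (x y : T) : nat :=
  find (fun n => has_walk n x y) (iota 0 #|T|).

Definition diam : nat := \max_(x : T) \max_(y : T) dist x y.

Definition strong : Prop := forall x y : T, connect e x y.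
End Distance.

Definition gdiam (G : sgraph) : nat := diam (@edge G).

Definition orientation (G : sgraph) (D : rel G) : Prop :=
  (forall x y : G, D x y -> edge x y) /\
  (forall x y : G, edge x y -> D x y (+) D y x).

Definition strong_orientation (G : sgraph) (D : rel G) : Prop :=
  orientation D /\ strong D.

(* k is the minimum diameter of a strong orientation of G. The minimum has to
   be attained, so no k qualifies when G has no strong orientation, that is
   (Robbins), when G is disconnected or has a bridge. *)
Definition is_orientation_number (G : sgraph) (k : nat) : Prop :=
  (exists2 D : rel G, strong_orientation D & diam D = k) /\
  (forall D : rel G, strong_orientation D -> k <= diam D).

Section VertexMultiplication.
Variables (G : sgraph) (s : G -> nat).

Definition vmult_vertex : finType := {x : G & 'I_(s x)}.

Definition vmult_edge (u v : vmult_vertex) : bool :=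
  (tag u != tag v) && edge (tag u) (tag v).

Lemma vmult_edge_sym : symmetric vmult_edge.
Proof. by move=> u v; rewrite /vmult_edge eq_sym edge_sym. Qed.

Lemma vmult_edge_irrefl : irreflexive vmult_edge.
Proof. by move=> u; rewrite /vmult_edge eqxx. Qed.

Definition vmult : sgraph := SGraph vmult_edge_sym vmult_edge_irrefl.
End VertexMultiplication.

(* in_class j s says that G(s) lies in the class C_j. The class refers to the
   diameter of the parent graph G, which G(s) does not determine up to
   isomorphism, so membership is a property of the pair (G, s). *)
Definition in_class (j : nat) (G : sgraph) (s : G -> nat) : Prop :=
  (forall x : G, 2 <= s x) /\
  is_orientation_number (vmult s) (gdiam G + j).

Section CartesianProduct.
Variables G H : sgraph.

Definition cart_edge (p q : G * H) : bool :=
  (p.1 == q.1) && edge p.2 q.2 || edge p.1 q.1 && (p.2 == q.2).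

Lemma cart_edge_sym : symmetric cart_edge.
Proof.
move=> p q; rewrite /cart_edge (eq_sym p.1) (eq_sym p.2).
by rewrite (edge_sym p.1) (edge_sym p.2).
Qed.

Lemma cart_edge_irrefl : irreflexive cart_edge.
Proof. by move=> p; rewrite /cart_edge !edge_irrefl andbF. Qed.

Definition cart : sgraph := SGraph cart_edge_sym cart_edge_irrefl.
End CartesianProduct.

(* The multiplicities of G^(n). *)
Definition uniform (G : sgraph) (n : nat) : G -> nat := fun=> n.
Arguments uniform : clear implicits.

(* Main.v *)
Require Import Defs.
From mathcomp Require Import all_boot.
From Stdlib Require Import Classical.

(** Let [D] be a strong orientation of G^(2). Orient every G-layer of
    (G x H)^(2) as [D], and orient every 4-cycle lying over an H-edge as a
    directed cycle. Every vertex then has an out-neighbour over each of its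
    neighbours in the H-direction, so a geodesic of H lifts from any vertex
    without loss of length, and one walk inside the final layer reaches any
    target. The diameter is thus at most [diam D + d(H)], while
    [d(G x H) = d(G) + d(H)] and no strong orientation of a
    vertex-multiplication has diameter below that of the parent graph. *)

Set Implicit Arguments.
Unset Strict Implicit.
Unset Printing Implicit Defensive.

Section Distance.
Variables (T : finType) (e : rel T).

(** [dist] is at most [#|T|], its default value, so a walk shorter than [dist] would have a length
    among those searched, and [find] would have stopped there. *)
Lemma dist_last_leq x p : path e x p -> dist e x (last x p) <= size p.
Proof.
move=> ep; rewrite leqNgt; apply/negP => lt_p.
have lt_pT : size p < #|T|.
  by apply: leq_trans lt_p _; rewrite -[leqRHS](size_iota 0) find_size.
have /negP[] := negbT (before_find 0 lt_p).
rewrite nth_iota // add0n; apply/existsP; exists (in_tuple p).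
by rewrite ep eqxx.
Qed.

(** Removing repeated vertices brings a walk below length [#|T|], so the search in [dist] succeeds
    and the length it returns is realised. *)
Lemma connect_geodesic x y : connect e x y ->
  exists p, [/\ path e x p, last x p = y & size p = dist e x y].
Proof.
case/connectP=> p0 /shortenP[p ep Up _] ->.
have lt_pT : size p < #|T|.
  by rewrite -[(size p).+1]/(size (x :: p)) -(card_uniqP Up) max_card.
have hasW : has (fun n => has_walk e n x (last x p)) (iota 0 #|T|).
  apply/hasP; exists (size p); first by rewrite mem_iota.
  by apply/existsP; exists (in_tuple p); rewrite ep eqxx.
have := nth_find 0 hasW; rewrite has_find size_iota in hasW.
rewrite nth_iota // add0n => /existsP[q /andP[eq /eqP lq]].
by exists q; rewrite size_tuple.
Qed.

Lemma dist_leq_diam x y : dist e x y <= diam e.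
Proof.
apply: leq_trans (leq_bigmax x); exact: (leq_bigmax (F := dist e x) y).
Qed.

Lemma diam_leqP k : reflect (forall x y, dist e x y <= k) (diam e <= k).
Proof.
apply: (iffP idP) => [le_k x y | le_k]; first exact: leq_trans (dist_leq_diam x y) le_k.
by apply/bigmax_leqP => x _; apply/bigmax_leqP => y _.
Qed.

Lemma diam_attained : 0 < #|T| -> exists x y, diam e = dist e x y.
Proof.
move=> T0; have [x dx] := eq_bigmax (fun x => \max_y dist e x y) T0.
by have [y dy] := eq_bigmax (dist e x) T0; exists x, y; rewrite /diam dx dy.
Qed.

End Distance.

(** The projection [tag] sends arcs to edges of [G], so a directed geodesic between two chosen
    copies becomes a walk of the same length in [G]. *)
Lemma gdiam_leq_vmult (G : sgraph) (s : G -> nat) (D : rel (vmult s)) :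
  (forall x, 0 < s x) -> strong_orientation D -> gdiam G <= diam D.
Proof.
move=> s0 [[De _] Ds]; apply/diam_leqP => x y.
pose c z : vmult s := Tagged (fun z => 'I_(s z)) (Ordinal (s0 z)).
have [p [Dp lp szp]] := connect_geodesic (Ds (c x) (c y)).
apply: leq_trans (dist_leq_diam D (c x) (c y)); rewrite -szp -(size_map tag).
have -> : y = last x (map tag p) by rewrite -[x]/(tag (c x)) last_map lp.
apply: dist_last_leq; apply: (homo_path (f := tag) _ Dp) => u v /De.
by case/andP.
Qed.

Lemma edge_vmultE (G : sgraph) (s : G -> nat) (p q : vmult s) :
  edge p q = (tag p != tag q) && edge (tag p) (tag q).
Proof. by []. Qed.

Section Cartesian.
Variables G H : sgraph.

Lemma edge_cartE (p q : cart G H) :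
  edge p q = (p.1 == q.1) && edge p.2 q.2 || edge p.1 q.1 && (p.2 == q.2).
Proof. by []. Qed.

(** Each edge of the product moves exactly one coordinate, so every step is charged to exactly one
    of the two projections. *)
Lemma cart_path_proj (p : cart G H) s : path (@edge (cart G H)) p s ->
  exists a b, [/\ path (@edge G) p.1 a, path (@edge H) p.2 b,
    last p s = (last p.1 a, last p.2 b) & size a + size b = size s].
Proof.
elim: s p => [|q s IHs] p /=; first by exists [::], [::]; case: p.
case/andP=> /orP[] /andP[e1 e2] /IHs[a [b [Ga Hb lab <-]]].
  exists a, (q.2 :: b); rewrite (eqP e1) /= addnS.
  by split=> //; apply/andP.
exists (q.1 :: a), b; rewrite (eqP e2) /= addSn.
by split=> //; apply/andP.
Qed.

Lemma cart_connected : connected G -> connected H -> connected (cart G H).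
Proof.
move=> [G0 cG] [H0 cH]; split=> [|[u x] [v y]].
  by rewrite card_prod muln_gt0 G0.
apply: (@connect_trans _ _ (u, y : H)).
  have /connectP[p Hp ->] := cH x y.
  apply/connectP; exists (map (pair u) p); last by rewrite last_map.
  by apply: homo_path Hp => a b; rewrite edge_cartE /= eqxx => ->.
have /connectP[p Gp ->] := cG u v.
apply/connectP; exists (map (pair^~ y) p); last by rewrite (last_map (pair^~ y)).
by apply: homo_path Gp => a b; rewrite edge_cartE /= eqxx andbT orbC => ->.
Qed.

Lemma gdiam_cart_geq : connected G -> connected H ->
  gdiam G + gdiam H <= gdiam (cart G H).
Proof.
move=> cG cH.
have [u [v]] := diam_attained (@edge G) cG.1.
have [x [y]] := diam_attained (@edge H) cH.1.
rewrite /gdiam => -> ->.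
have [s [es ls szs]] :=
  connect_geodesic ((cart_connected cG cH).2 (u, x) (v, y)).
apply: leq_trans (dist_leq_diam (@edge (cart G H)) (u, x) (v, y)).
have [a [b [Ga Hb]]] := cart_path_proj es.
rewrite -szs ls => -[-> ->] <-; apply: leq_add; exact: dist_last_leq.
Qed.

Definition copy (K : sgraph) (x : K) (i : 'I_2) : vmult (uniform K 2) :=
  existT (fun z => 'I_(uniform K 2 z)) x i.

(* Over an H-edge with [x] ranked before [y], this is the directed cycle
   (x,0) -> (y,0) -> (x,1) -> (y,1) -> (x,0). *)
Definition cart_orient (D : rel (vmult (uniform G 2))) :
    rel (vmult (uniform (cart G H) 2)) :=
  fun p q =>
    let: (u, x) := tag p in let: (v, y) := tag q in
    let i : 'I_2 := tagged p in let j : 'I_2 := tagged q in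
    if x == y then D (copy u i) (copy v j)
    else [&& u == v, edge x y & (enum_rank x < enum_rank y) == (i == j)].

Variable D : rel (vmult (uniform G 2)).

Lemma cart_orient_orientation : orientation D -> orientation (cart_orient D).
Proof.
case=> De Dx; split=> -[[u x] i] [[v y] j];
  rewrite /cart_orient edge_vmultE edge_cartE /=.
  case: (x =P y) => [<- /De | /eqP neq_xy /and3P[/eqP<- exy _]].
    rewrite edge_vmultE /= => /andP[neq_uv euv].
    by rewrite euv orbT andbT; apply: contraNneq neq_uv => -[->].
  by rewrite xpair_eqE eqxx /= neq_xy exy.
case/andP=> _; rewrite (eq_sym y) (edge_sym y).
case: (x =P y) => [<- | /eqP neq_xy].
  rewrite edge_irrefl andbF andbT /= => euv; apply: Dx.
  rewrite edge_vmultE /= euv andbT.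
  by apply: contraTneq euv => ->; rewrite edge_irrefl.
rewrite andbF orbF => /andP[/eqP<- ->]; rewrite eqxx /= (eq_sym j).
(* Swapping the endpoints negates the comparison of the distinct ranks and keeps the truth value of
   [i == j], so exactly one direction is chosen. *)
have neq_r : enum_rank x != enum_rank y by rewrite (inj_eq enum_rank_inj).
by case: ltngtP (neq_r) => [||/val_inj->]; rewrite ?eqxx //; case: (i == j).
Qed.

Lemma cart_orient_lift u x i s : path (@edge H) x s ->
  exists t j, [/\ path (cart_orient D) (copy ((u, x) : cart G H) i) t,
    last (copy ((u, x) : cart G H) i) t = copy ((u, last x s) : cart G H) j
    & size t = size s].
Proof.
elim: s x i => [|y s IHs] x i /=; first by exists [::], i.
case/andP=> exy /IHs hs.
(* The arc condition forces this index: going up in rank keeps the copy, going down switches to the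
   other one, as [rev_ord] has no fixed point on ['I_2]. *)
pose j := if enum_rank x < enum_rank y then i else rev_ord i.
have [t [k [Dt lt szt]]] := hs j.
exists (copy ((u, y) : cart G H) j :: t), k; rewrite /= szt; split=> //.
rewrite Dt andbT /cart_orient /= eqxx exy.
have /negPf-> : x != y by apply: contraTneq exy => ->; rewrite edge_irrefl.
rewrite /j; case: ifP => _; first by rewrite eqxx.
by case: i {hs j Dt lt} => -[|[|]].
Qed.

Lemma cart_orient_walk p q : connected H -> strong D ->
  exists t, [/\ path (cart_orient D) p t, last p t = q
    & size t <= diam D + gdiam H].
Proof.
case: p q => [[u x] i] [[v y] j] [_ cH] Ds.
have [s [Hs <- szs]] := connect_geodesic (cH x y).
have [t [k [Dt lt szt]]] := cart_orient_lift u i Hs.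
(* The lift does not control the index [k] on arrival; this single geodesic of [D] corrects the
   index and the G-coordinate together. *)
have [r [Dr lr szr]] := connect_geodesic (Ds (copy u k) (copy v j)).
pose layer (w : vmult (uniform G 2)) : vmult (uniform (cart G H) 2) :=
  copy ((tag w, last x s) : cart G H) (tagged w).
exists (t ++ map layer r); rewrite cat_path last_cat lt Dt size_cat size_map.
rewrite -[copy _ k]/(layer (copy u k)) last_map lr; split=> //=.
  apply: homo_path Dr => -[a a'] [b b'].
  by rewrite /cart_orient /= eqxx.
by rewrite addnC leq_add // ?szr ?szt ?szs dist_leq_diam.
Qed.

Lemma cart_orient_strong : connected H -> strong_orientation D ->
  strong_orientation (cart_orient D).
Proof.
move=> cH [oD Ds]; split; first exact: cart_orient_orientation.
move=> p q; have [t [Dt <- _]] := cart_orient_walk p q cH Ds.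
by apply/connectP; exists t.
Qed.

Lemma diam_cart_orient : connected H -> strong D ->
  diam (cart_orient D) <= diam D + gdiam H.
Proof.
move=> cH Ds; apply/diam_leqP => p q.
have [t [Dt <- szt]] := cart_orient_walk p q cH Ds.
exact: leq_trans (dist_last_leq Dt) szt.
Qed.

End Cartesian.

(** The product adds at most [gdiam H] to the diameter of the orientation and at least [gdiam H] to
    that of the parent graph, so the excess [j] does not grow. *)
Lemma in_class_cart_bound (G H : sgraph) j :
  connected G -> connected H -> in_class j (uniform G 2) ->
  exists2 D : rel (vmult (uniform (cart G H) 2)),
    strong_orientation D & diam D <= gdiam (cart G H) + j.
Proof.
move=> cG cH [_ [[D sD dD] _]].
exists (cart_orient D); first exact: cart_orient_strong.
apply: leq_trans (diam_cart_orient cH sD.2) _.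
by rewrite dD addnAC leq_add2r gdiam_cart_geq.
Qed.

Theorem theorem1p5 (G H : sgraph) (connG : connected G) (connH : connected H)
    (diamG : 2 <= gdiam G) :
  (in_class 0 (uniform G 2) -> in_class 0 (uniform (cart G H) 2)) /\
  (in_class 1 (uniform G 2) ->
     in_class 0 (uniform (cart G H) 2) \/ in_class 1 (uniform (cart G H) 2)).
Proof.
have lower (D : rel (vmult (uniform (cart G H) 2))) :
  strong_orientation D -> gdiam (cart G H) <= diam D by exact: gdiam_leq_vmult.
have class0 (D : rel (vmult (uniform (cart G H) 2))) :
    strong_orientation D -> diam D <= gdiam (cart G H) ->
    in_class 0 (uniform (cart G H) 2).
  move=> sD dD; split=> //; rewrite addn0; split=> //.
  by exists D => //; apply/eqP; rewrite eqn_leq dD lower.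
split=> /(in_class_cart_bound connG connH)[D sD].
  by rewrite addn0; apply: class0.
rewrite addn1 => dD.
(* Outside class 0 no strong orientation attains the parent diameter, so the lower bound rises by
   one and meets the diameter of [D]. *)
have [|n0] := classic (in_class 0 (uniform (cart G H) 2)); [by left | right].
have lower1 (E : rel (vmult (uniform (cart G H) 2))) :
    strong_orientation E -> gdiam (cart G H) < diam E.
  by move=> sE; rewrite ltnNge; apply/negP => /(class0 _ sE).
split=> //; rewrite addn1; split=> //.
by exists D => //; apply/eqP; rewrite eqn_leq dD lower1.
Qed.
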